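(* Let $\mathbb{K}$ be a field of characteristic $0$, $(R,\mathfrak{m})$ a parameter $\mathbb{K}$-algebra, and $C$ a smooth integral commutative $\mathbb{K}$-algebra. Let $\star$ and $\star'$ be two star products on the augmented $R$-module $A:=R\hat\otimes C$, and let $g$ be a gauge transformation of $A$ satisfying $g(a_1\star a_2)=g(a_1)\star'g(a_2)$ for all $a_1,a_2\in A$. Assume that $\star$ is a differential star product. Then the following are equivalent: (i) the star product $\star'$ is also differential; (ii) the gauge transformation $g$ is differential.
   Context: A parameter $\mathbb{K}$-algebra is a complete local noetherian commutative $\mathbb{K}$-algebra $R$ with maximal ideal $\mathfrak{m}$ and $R/\mathfrak{m}=\mathbb{K}$. For a $\mathbb{K}$-module $V$, $R\hat\otimes V$ and $\mathfrak{m}\hat\otimes V$ are the $\mathfrak{m}$-adic completions of $R\otimes_{\mathbb{K}}V$ and $\mathfrak{m}\otimes_{\mathbb{K}}V$. $A=R\hat\otimes C$ is an $R$-module with augmentation $A\to C$ and distinguished element $1_A=1_R\otimes1_C$. A star product on $A$ is an $R$-bilinear map $\star:A\times A\to A$ making $A$ an associative $R$-algebra with unit $1_A$ such that $c_1\star c_2\equiv c_1c_2\bmod\mathfrak{m}$ for $c_1,c_2\in C$. A gauge transformation of $A$ is an $R$-module automorphism commuting with the augmentation to $C$ and fixing $1_A$; every such $g$ lies in $R\hat\otimes\operatorname{End}_{\mathbb{K}}(C)$ (acting on $A$ by $R$-linear continuous extension) with $g\equiv 1\bmod\mathfrak{m}$, so $\log(g)=\sum_{k\ge1}\frac{(-1)^{k+1}}{k}(g-1)^k\in\mathfrak{m}\hat\otimes\operatorname{End}_{\mathbb{K}}(C)$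 converges $\mathfrak{m}$-adically. Let $\mathcal{D}^{\mathrm{nor},0}_{\mathrm{poly}}(C)$ be the $\mathbb{K}$-module of differential operators $\gamma:C\to C$ (Grothendieck's sense) with $\gamma(1)=0$, and $\mathcal{D}^{\mathrm{nor},1}_{\mathrm{poly}}(C)$ the $\mathbb{K}$-module of $\mathbb{K}$-bilinear maps $\phi:C\times C\to C$ that are differential operators of bounded order in each argument and vanish when either argument is $1$. A gauge transformation $g$ is differential if $\log(g)\in\mathfrak{m}\hat\otimes\mathcal{D}^{\mathrm{nor},0}_{\mathrm{poly}}(C)$. A star product $\star$ is differential if $c_1\star c_2=c_1c_2+\omega(c_1,c_2)$ for all $c_1,c_2\in C$ for some $\omega\in\mathfrak{m}\hat\otimes\mathcal{D}^{\mathrm{nor},1}_{\mathrm{poly}}(C)$ (extended $R$-bilinearly). *)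

(* Defs.v *)
From HB Require Import structures.
From mathcomp Require Import all_boot all_order all_algebra.
Set Implicit Arguments. Unset Strict Implicit. Unset Printing Implicit Defensive.
Import Order.TTheory GRing.Theory Num.Theory.
Local Open Scope ring_scope.

Definition ideal (T : pzRingType) (I : T -> Prop) : Prop :=
  I 0 /\ (forall x y, I x -> I y -> I (x + y)) /\ (forall r x, I x -> I (r * x)).

Definition is_unit (T : pzRingType) (r : T) : Prop := exists s, r * s = 1.

Definition klinear (K : fieldType) (V W : lmodType K) (f : V -> W) : Prop :=
  forall (a : K) x y, f (a *: x + y) = a *: f x + f y.

Section Param.
Context {K : fieldType} {R : comAlgType K}.

(* the maximal ideal m = the non-units (R is local) *)
Definition inm (r : R) : Prop := ~ is_unit r.

Fixpoint mpow (n : nat) (r : R) : Prop :=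
  match n with
  | 0 => True
  | n'.+1 => exists (a b : seq R), size a = size b /\
      (forall i, (i < size a)%N -> inm a`_i /\ mpow n' b`_i) /\
      r = \sum_(i < size a) a`_i * b`_i
  end.

Definition noetherian : Prop :=
  forall I : R -> Prop, ideal I ->
  exists s : seq R, (forall i, (i < size s)%N -> I s`_i) /\
    forall x, I x -> exists t : seq R, size t = size s /\
      x = \sum_(i < size s) t`_i * s`_i.

Definition param_algebra : Prop :=
  [/\ (forall x y, inm x -> inm y -> inm (x + y)),
      (forall r, exists k : K, inm (r - k%:A)),
      noetherian,
      (forall s : nat -> R, (forall n, mpow n (s n.+1 - s n)) ->
         exists l, forall n, mpow n (l - s n))
    & (forall r, (forall n, mpow n r) -> r = 0)].

(* continuous K-linear functionals on R (those vanishing on some m^n) *)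
Definition isRd (l : R -> K) : Prop :=
  (forall (a : K) x y, l (a *: x + y) = a * l x + l y) /\
  exists n, forall r, mpow n r -> l r = 0.

Definition isEps (e : R -> K) : Prop := forall r, inm (r - (e r)%:A).
End Param.

Section CSide.
Context {K : fieldType} {C : comAlgType K}.

Definition integral_alg : Prop :=
  (1 : C) != 0 /\ forall x y : C, x * y = 0 -> x = 0 \/ y = 0.

Definition fin_gen : Prop :=
  exists s : seq C, forall P : C -> Prop,
    P 1 -> (forall i, (i < size s)%N -> P s`_i) ->
    (forall x y, P x -> P y -> P (x + y)) ->
    (forall x y, P x -> P y -> P (x * y)) ->
    (forall (a : K) x, P x -> P (a *: x)) -> forall x, P x.

Definition formally_smooth : Prop :=
  forall (B : comAlgType K) (J : B -> Prop), ideal J ->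
  (forall x y, J x -> J y -> x * y = 0) ->
  forall f : C -> B,
    J (f 1 - 1) ->
    (forall x y, J (f (x + y) - (f x + f y))) ->
    (forall x y, J (f (x * y) - f x * f y)) ->
    (forall (a : K) x, J (f (a *: x) - a *: f x)) ->
  exists h : C -> B,
    [/\ h 1 = 1, (forall x y, h (x + y) = h x + h y),
        (forall x y, h (x * y) = h x * h y),
        (forall (a : K) x, h (a *: x) = a *: h x)
      & forall x, J (h x - f x)].

Definition smooth_alg : Prop := fin_gen /\ formally_smooth.

(* Grothendieck differential operators of order <= k *)
Fixpoint Dord (k : nat) (g : C -> C) : Prop :=
  match k with
  | 0 => forall a x, g (a * x) = a * g x
  | k'.+1 => forall a, Dord k' (fun x => g (a * x) - a * g x)
  end.

Definition diffop (g : C -> C) : Prop := klinear g /\ exists k, Dord k g.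

Definition Dnor0 (g : C -> C) : Prop := diffop g /\ g 1 = 0.

Definition Dnor1 (p : C -> C -> C) : Prop :=
  (forall c, klinear (p c) /\ klinear (fun x => p x c)) /\
  (exists k, forall c, Dord k (p c) /\ Dord k (fun x => p x c)) /\
  (forall c, p 1 c = 0 /\ p c 1 = 0).
End CSide.

(* An element of A is represented by a K-linear map R' -> C, where R' is
   the space of continuous functionals (isRd); values outside R' are
   irrelevant (equality eqA only looks at R'). *)
Section Tensor.
Context {K : fieldType} {R C : comAlgType K}.

Definition Araw := (R -> K) -> C.

Definition isA (p : Araw) : Prop :=
  forall (a : K) l1 l2, isRd l1 -> isRd l2 ->
    p (fun r => a * l1 r + l2 r) = a *: p l1 + p l2.

Definition eqA (p q : Araw) : Prop := forall l, isRd l -> p l = q l.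

Definition addA (p q : Araw) : Araw := fun l => p l + q l.

Definition scaleA (r : R) (p : Araw) : Araw := fun l => p (fun s => l (r * s)).

(* the inclusion C -> A, c |-> 1 (x) c *)
Definition iotaA (c : C) : Araw := fun l => l 1 *: c.

Definition star_product (st : Araw -> Araw -> Araw) : Prop :=
  ((forall p q, isA p -> isA q -> isA (st p q)) /\
      (forall p p' q q', isA p -> isA p' -> isA q -> isA q' ->
         eqA p p' -> eqA q q' -> eqA (st p q) (st p' q')) /\
      (forall p1 p2 q, isA p1 -> isA p2 -> isA q ->
         eqA (st (addA p1 p2) q) (addA (st p1 q) (st p2 q)) /\
         eqA (st q (addA p1 p2)) (addA (st q p1) (st q p2))) /\
      (forall r p q, isA p -> isA q ->
         eqA (st (scaleA r p) q) (scaleA r (st p q)) /\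
         eqA (st p (scaleA r q)) (scaleA r (st p q))) /\
      (forall p q s, isA p -> isA q -> isA s ->
         eqA (st (st p q) s) (st p (st q s))) /\
      (forall p, isA p -> eqA (st (iotaA 1) p) p /\ eqA (st p (iotaA 1)) p)
    /\ (forall c1 c2 e, isEps e -> st (iotaA c1) (iotaA c2) e = c1 * c2)).

Definition gauge (g : Araw -> Araw) : Prop :=
  ((forall p, isA p -> isA (g p)) /\
      (forall p q, isA p -> isA q -> eqA p q -> eqA (g p) (g q)) /\
      (forall p q, isA p -> isA q -> eqA (g (addA p q)) (addA (g p) (g q))) /\
      (forall r p, isA p -> eqA (g (scaleA r p)) (scaleA r (g p))) /\
      (exists h : Araw -> Araw, (forall p, isA p -> isA (h p)) /\
         forall p, isA p -> eqA (g (h p)) p /\ eqA (h (g p)) p) /\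
      (forall p e, isA p -> isEps e -> g p e = p e)
    /\ eqA (g (iotaA 1)) (iotaA 1)).

(* differential star product: c1*c2 = c1c2 + omega(c1,c2), omega in m^(x)D^{nor,1} *)
Definition diff_star (st : Araw -> Araw -> Araw) : Prop :=
  exists om : (R -> K) -> C -> C -> C,
    [/\ (forall (a : K) l1 l2, isRd l1 -> isRd l2 ->
           om (fun r => a * l1 r + l2 r) = (fun x y => a *: om l1 x y + om l2 x y)),
        (forall e, isEps e -> forall x y, om e x y = 0),
        (forall l, isRd l -> Dnor1 (om l))
      & (forall c1 c2 l, isRd l ->
           st (iotaA c1) (iotaA c2) l = l 1 *: (c1 * c2) + om l c1 c2)].

Definition gm1 (g : Araw -> Araw) (p : Araw) : Araw := fun l => g p l - p l.

(* differential gauge: log g = sum_{k>=1} (-1)^(k+1)/k (g-1)^k, viewed as an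
   element of R ^(x) End(C) (via its restriction to C), lies in m ^(x) D^{nor,0}.
   On a functional l vanishing on m^n the series is the finite sum k = 1..n. *)
Definition diff_gauge (g : Araw -> Araw) : Prop :=
  exists G : (R -> K) -> C -> C,
    [/\ (forall (a : K) l1 l2, isRd l1 -> isRd l2 ->
           G (fun r => a * l1 r + l2 r) = (fun x => a *: G l1 x + G l2 x)),
        (forall e, isEps e -> forall x, G e x = 0),
        (forall l, isRd l -> Dnor0 (G l))
      & (forall c l n, isRd l -> (forall r, mpow n r -> l r = 0) ->
           G l c = \sum_(1 <= k < n.+1)
                     (((-1) ^+ k.+1 / k%:R) *: iter k (gm1 g) (iotaA c) l))].
End Tensor.

(* Main.v *)
From HB Require Import structures.
From mathcomp Require Import all_boot all_order all_algebra.
From mathcomp Require Import boolp classical_sets functions.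
Require Import Defs.
Set Implicit Arguments. Unset Strict Implicit. Unset Printing Implicit Defensive.
Import GRing.Theory.
Local Open Scope ring_scope.

(** Write [g_l c := g (1 (x) c) l] for a continuous functional [l], and [N := g - 1]. Everything
    goes by induction on the [n] such that [l] kills [m^n].

    If both star products are differential, expanding [g (x * y) = g x *' g y] at [l] gives
    [g_l (x y) - x (g_l y)] in terms of the two bidifferential families and of [g_(l (r * _))] with
    [r] in [m]; the latter functionals kill [m^(n-1)]. Hence the commutators of [g_l] with
    multiplications are differential operators of uniformly bounded order, so [g_l] is one too,
    and so are the components of [log g], which are finite sums of compositions of them.

    Conversely [N_l] is the [l]-component of [log g] minus terms of degree at least two in [N],
    which only involve functionals of lower level; likewise for the inverse of [g], and then
    [x *' y = g (g^-1 x * g^-1 y)].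

    These expansions are legitimate because an [R]-linear endomorphism of [A] preserves the
    subspace of elements vanishing on the functionals that kill [m^n]: it is [m^n A] since [m^n]
    is finitely generated. *)

(** * Extension of linear maps from a subspace, by Zorn's lemma *)

Section LinearExtension.
Context {K : fieldType} {V W : lmodType K}.
Local Open Scope classical_set_scope.

(** Graphs of linear maps on a subspace of [V]; by linearity, single-valuedness only has to be
    required over [0]. *)
Definition lin_graph (G : set (V * W)) : Prop :=
  [/\ G 0, (forall (a : K) x y, G x -> G y -> G (a *: x + y)) &
      forall w, G (0, w) -> w = 0].

(** A maximal graph containing [G0] is total: a vector [v] outside its domain could be adjoined with
    value [0]. *)
Lemma lin_graph_ext (G0 : set (V * W)) : lin_graph G0 ->
  exists F : V -> W, klinear F /\ forall v w, G0 (v, w) -> F v = w.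
Proof.
move=> hG0.
(* The empty set is admitted only because [Zorn_bigcup] includes the empty chain. *)
pose P (G : set (V * W)) := G = set0 \/ (lin_graph G /\ G0 `<=` G).
have [F FP Ftot|G [PG maxG]] := @Zorn_bigcup _ P.
  have [[X [FX Xne]]|Fe] := pselect (exists X, F X /\ X <> set0); last first.
    left; apply/seteqP; split=> // x [X FX Xx]; exfalso.
    by apply: Fe; exists X; split=> // X0; rewrite X0 in Xx.
  have nz Y y : F Y -> Y y -> lin_graph Y /\ G0 `<=` Y.
    by move=> FY Yy; have [Y0|//] := FP _ FY; rewrite Y0 in Yy.
  have [//|[[X0 _ _] GX]] := FP _ FX.
  right; split; last by move=> x /GX Xx; exists X.
  split; first by exists X.
  - move=> a x y [Y FY Yx] [Z FZ Zy].
    have [[_ aY _] _] := nz _ _ FY Yx; have [[_ aZ _] _] := nz _ _ FZ Zy.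
    have [YZ|ZY] := Ftot _ _ FY FZ.
      by exists Z => //; apply: aZ => //; apply: YZ.
    by exists Y => //; apply: aY => //; apply: ZY.
  - move=> w [Y FY Yw]; have [[_ _ Y3] _] := nz _ _ FY Yw; exact: Y3.
have {PG} [[G00 aG fG] G0G] : lin_graph G /\ G0 `<=` G.
  case: PG => [GE|//]; exfalso; apply: (maxG G0); last by right; split.
  rewrite GE; split; last by move=> G0e; have [h _ _] := hG0; have := G0e _ h.
  by move=> x.
have tot v : exists w, G (v, w).
  apply: contrapT => nv.
  pose G' : set (V * W) := [set x | exists b : K, G (x - b *: (v, 0))].
  apply: (maxG G').
    split=> [x Gx|G'G]; first by exists 0; rewrite scale0r subr0.
    apply: nv; exists 0; apply: G'G; exists 1.
    by rewrite scale1r subrr.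
  right; split; last by move=> x /G0G Gx; exists 0; rewrite scale0r subr0.
  split; first by exists 0; rewrite scale0r subr0.
  - move=> a x y [b Gb] [c Gc]; exists (a * b + c).
    have := aG a _ _ Gb Gc; congr (G _).
    by rewrite scalerBr scalerDl scalerA opprD addrACA.
  - move=> w [b Gb]; have [b0|b0] := eqVneq b 0.
      by apply: fG; move: Gb; rewrite b0 scale0r subr0.
    (* Here [(- b *: v, w)] lies in [G], so [v] would already be in the domain of [G]. *)
    exfalso; apply: nv; exists (- b^-1 *: w).
    have := aG (- b^-1) _ _ Gb G00; congr (G _).
    rewrite addr0 scalerBr; congr pair; rewrite /= ?scaler0 ?subr0 ?sub0r //.
    by rewrite scaleNr opprK scalerA mulVf // scale1r.
have [F hF] := choice tot.
have uniqG v w w' : G (v, w) -> G (v, w') -> w = w'.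
  move=> h h'; apply/eqP; rewrite -subr_eq0; apply/eqP/fG.
  have := aG (-1) _ _ h' h; congr (G _).
  by rewrite scaleN1r; congr pair; rewrite /= addrC // subrr.
exists F; split; last by move=> v w /G0G h; apply: uniqG h.
move=> a x y; apply: uniqG (hF _) _.
exact: aG a _ _ (hF x) (hF y).
Qed.

End LinearExtension.

(** * Elementary rules for [klinear] maps *)

Section KLinear.
Context {K : fieldType}.
Implicit Types U V W : lmodType K.

Lemma klinear0 V W (f : V -> W) : klinear f -> f 0 = 0.
Proof.
move=> h; have := h 1 0 0; rewrite !scale1r addr0 => e.
by apply: (addrI (f 0)); rewrite -e addr0.
Qed.

Lemma klinearD V W (f : V -> W) : klinear f -> {morph f : x y / x + y}.
Proof. by move=> h x y; have := h 1 x y; rewrite !scale1r. Qed.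

Lemma klinearZ V W (f : V -> W) : klinear f -> forall a x, f (a *: x) = a *: f x.
Proof. by move=> h a x; have := h a x 0; rewrite (klinear0 h) !addr0. Qed.

Lemma klinearB V W (f : V -> W) : klinear f -> {morph f : x y / x - y}.
Proof. by move=> h x y; rewrite (klinearD h) -scaleN1r (klinearZ h) scaleN1r. Qed.

Lemma klinear_sum V W (f : V -> W) I (s : seq I) (F : I -> V) : klinear f ->
  f (\sum_(i <- s) F i) = \sum_(i <- s) f (F i).
Proof.
move=> h; elim: s => [|i s IH]; first by rewrite !big_nil klinear0.
by rewrite !big_cons klinearD // IH.
Qed.

Lemma klinear_comp U V W (f : V -> W) (f' : U -> V) :
  klinear f -> klinear f' -> klinear (fun x => f (f' x)).
Proof. by move=> h h' a x y; rewrite h' h. Qed.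

End KLinear.

(** * Differential operators on [C], and families of uniformly bounded order *)

Section UniformDiffOps.
Context {K : fieldType} {C : comAlgType K}.

Lemma Dord_zero k : @Dord K C k (fun _ => 0).
Proof.
elim: k => [|k IH] a; first by move=> x; rewrite mulr0.
by move: IH; congr Dord; apply/funext => x; rewrite mulr0 subrr.
Qed.

Lemma DordS k (f : C -> C) : Dord k f -> Dord k.+1 f.
Proof.
elim: k f => [|k IH] f h; last by move=> a; apply: IH; apply: h.
move=> a; have := Dord_zero 0; congr Dord.
by apply/funext => x; rewrite h subrr.
Qed.

Lemma Dord_le k k' (f : C -> C) : (k <= k')%N -> Dord k f -> Dord k' f.
Proof.
move=> /subnKC <- h; elim: (k' - k)%N => [|d IH]; first by rewrite addn0.
by rewrite addnS; apply: DordS.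
Qed.

Lemma Dord_lin k b (f f' : C -> C) : Dord k f -> Dord k f' ->
  Dord k (fun x => b *: f x + f' x).
Proof.
elim: k f f' => [|k IH] f f' h h' a /=.
  by move=> x; rewrite h h' mulrDr scalerAr.
have := IH _ _ (h a) (h' a); congr Dord; apply/funext => x.
by rewrite mulrDr opprD addrACA scalerBr scalerAr.
Qed.

Lemma klinear_comm (f : C -> C) a :
  klinear f -> klinear (fun x => f (a * x) - a * f x).
Proof.
move=> h b x y; rewrite mulrDr -scalerAr !h mulrDr opprD addrACA.
by rewrite scalerBr scalerAr.
Qed.

Lemma Dord_comp k k' (f f' : C -> C) : klinear f -> klinear f' ->
  Dord k f -> Dord k' f' -> Dord (k + k') (fun x => f (f' x)).
Proof.
(* [[f f', a] = f [f', a] + [f, a] f'] *)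
have [n le_n] := ubnP (k + k'); elim: n k k' f f' le_n => // n IH k k' f f'.
rewrite ltnS => le_n lf lf' h h'.
have key a x : f (f' (a * x)) - a * f (f' x) =
   f (f' (a * x) - a * f' x) + (f (a * f' x) - a * f (f' x)).
  by rewrite (klinearB lf) addrA subrK.
case: k k' h h' le_n => [|k] [|k'] h h' le_n.
- by move=> a x; rewrite h' h.
- rewrite add0n => a.
  have := IH 0%N k' f _ le_n lf (klinear_comm a lf') h (h' a); congr Dord.
  by apply/funext => x; rewrite key h subrr addr0.
- rewrite addn0 => a.
  have := IH k 0%N _ f' _ (klinear_comm a lf) lf' (h a) h'.
  rewrite addn0; move: le_n; rewrite addn0 => le_n /(_ le_n); congr Dord.
  by apply/funext => x; rewrite key h' subrr (klinear0 lf) add0r.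
move=> a; have -> : (fun x => f (f' (a * x)) - a * f (f' x)) = fun x =>
    1 *: f (f' (a * x) - a * f' x) + (f (a * f' x) - a * f (f' x)).
  by apply/funext => x; rewrite scale1r key.
move: le_n; rewrite addSn => le_n.
apply: Dord_lin; last first.
  exact: IH (klinear_comm a lf) lf' (h a) h'.
rewrite addnS -addSn; apply: IH (klinear_comm a lf') h (h' a) => //.
by rewrite addSn -addnS.
Qed.

(** One order bound serves all parameters. [Dnor1] asks for this in each argument, and the recursive
    clause of [Dord] asks for it of the commutators with all [a] ([diffop_of_comm]). *)
Definition unif_diff (X : Type) (F : X -> C -> C) : Prop :=
  exists k, forall x, klinear (F x) /\ Dord k (F x).

Lemma unif_diff_eq X (F G : X -> C -> C) : F =2 G -> unif_diff F -> unif_diff G.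
Proof.
by move=> FG; congr unif_diff; apply/funext => x; apply/funext => c; apply: FG.
Qed.

Lemma unif_diff0 X : unif_diff (fun (_ : X) _ => 0).
Proof.
by exists 0%N => _; split; [move=> a x y; rewrite scaler0 addr0 | apply: Dord_zero].
Qed.

Lemma unif_diff_id X : unif_diff (fun (_ : X) c => c).
Proof. by exists 0%N. Qed.

Lemma unif_diff_lin X a (F G : X -> C -> C) : unif_diff F -> unif_diff G ->
  unif_diff (fun x c => a *: F x c + G x c).
Proof.
move=> [k hF] [k' hG]; exists (maxn k k') => x.
have [lF dF] := hF x; have [lG dG] := hG x; split.
  move=> b y z; rewrite lF lG !scalerDr !scalerA addrACA.
  by rewrite [a * b]mulrC.
apply: Dord_lin.
  by apply: Dord_le dF; apply: leq_maxl.
by apply: Dord_le dG; apply: leq_maxr.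
Qed.

Lemma unif_diffD X (F G : X -> C -> C) : unif_diff F -> unif_diff G ->
  unif_diff (fun x c => F x c + G x c).
Proof.
move=> hF hG; apply: unif_diff_eq (unif_diff_lin 1 hF hG) => x c.
by rewrite scale1r.
Qed.

Lemma unif_diffZ X a (F : X -> C -> C) : unif_diff F ->
  unif_diff (fun x c => a *: F x c).
Proof.
move=> hF; apply: unif_diff_eq (unif_diff_lin a hF (@unif_diff0 X)) => x c.
by rewrite addr0.
Qed.

Lemma unif_diffB X (F G : X -> C -> C) : unif_diff F -> unif_diff G ->
  unif_diff (fun x c => F x c - G x c).
Proof.
move=> hF hG; apply: unif_diff_eq (unif_diff_lin (-1) hG hF) => x c.
by rewrite scaleN1r addrC.
Qed.

Lemma unif_diff_sum X (I : Type) (s : seq I) (F : I -> X -> C -> C) :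
  (forall i, unif_diff (F i)) -> unif_diff (fun x c => \sum_(i <- s) F i x c).
Proof.
move=> hF; elim: s => [|i s IH].
  apply: unif_diff_eq (@unif_diff0 X) => x c.
  by rewrite big_nil.
apply: unif_diff_eq (unif_diffD (hF i) IH) => x c.
by rewrite big_cons.
Qed.

Lemma unif_diff_comp X (F G : X -> C -> C) : unif_diff F -> unif_diff G ->
  unif_diff (fun x c => F x (G x c)).
Proof.
move=> [k hF] [k' hG]; exists (k + k')%N => x.
have [lF dF] := hF x; have [lG dG] := hG x; split; first exact: klinear_comp.
exact: Dord_comp.
Qed.

Lemma unif_diff_reindex X Y (f : Y -> X) (F : X -> C -> C) :
  unif_diff F -> unif_diff (fun y => F (f y)).
Proof. by move=> [k hF]; exists k => y. Qed.

Lemma diffopP (f : C -> C) : diffop f <-> unif_diff (fun _ : unit => f).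
Proof.
by split=> [[lf [k df]]|[k /(_ tt) [lf df]]]; [exists k | split=> //; exists k].
Qed.

Lemma diffop_of_comm (f : C -> C) : klinear f ->
  unif_diff (fun a x => f (a * x) - a * f x) -> diffop f.
Proof. by move=> lf [k hk]; split=> //; exists k.+1 => a; have [] := hk a. Qed.

End UniformDiffOps.

(** * Functionals on [R] and finite coordinates modulo powers of the maximal ideal *)

Section ParameterAlgebra.
Context {K : fieldType} {R : comAlgType K}.
Implicit Types (l : R -> K) (e : R -> K).
Local Arguments mpow : simpl never.

Definition Rlinear l : Prop := forall (a : K) x y, l (a *: x + y) = a * l x + l y.

(** These functionals are the dual of [R / m^n]; together they exhaust the continuous
    functionals. *)
Definition level n l : Prop := Rlinear l /\ forall r, mpow n r -> l r = 0.

Definition shift (r : R) l : R -> K := fun s => l (r * s).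

Lemma level_isRd n l : level n l -> isRd l.
Proof. by move=> [? ?]; split=> //; exists n. Qed.

Lemma isRd_level l : isRd l -> exists n, level n l.
Proof. by move=> [h [n hn]]; exists n. Qed.

Lemma level_lin n a l1 l2 : level n l1 -> level n l2 ->
  level n (fun r => a * l1 r + l2 r).
Proof.
move=> [h1 k1] [h2 k2]; split; last by move=> r hr; rewrite k1 // k2 // mulr0 addr0.
move=> b x y; rewrite h1 h2 !mulrDr addrACA !mulrA; congr (_ + _ + _).
by rewrite [a * b]mulrC.
Qed.

Lemma level0_eq l : level 0 l -> l = fun=> 0.
Proof. by move=> [_ h]; apply/funext => r; apply: h. Qed.

Lemma Rlinear0 l : Rlinear l -> l 0 = 0.
Proof. exact: (@klinear0 K R K^o). Qed.

Lemma RlinearB l : Rlinear l -> {morph l : x y / x - y}.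
Proof. exact: (@klinearB K R K^o). Qed.

Lemma RlinearZ l : Rlinear l -> forall a x, l (a *: x) = a * l x.
Proof. exact: (@klinearZ K R K^o). Qed.

Lemma Rlinear_sum l I (s : seq I) (F : I -> R) : Rlinear l ->
  l (\sum_(i <- s) F i) = \sum_(i <- s) l (F i).
Proof. exact: (@klinear_sum K R K^o). Qed.

Lemma Rlinear_shift r l : Rlinear l -> Rlinear (shift r l).
Proof. by move=> h a x y; rewrite /shift mulrDr -scalerAr h. Qed.

Lemma inmM (r x : R) : inm x -> inm (r * x).
Proof.
by move=> hx [s rxs]; apply: hx; exists (r * s); rewrite mulrA [x * r]mulrC.
Qed.

Lemma mpow0 n : @mpow K R n 0.
Proof.
case: n => [//|n]; exists [::], [::]; split=> //; split=> //.
by rewrite big_ord0.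
Qed.

Lemma mpowD n (x y : R) : mpow n x -> mpow n y -> mpow n (x + y).
Proof.
case: n x y => [//|n] x y [a [b [sab [hab ->]]]] [c [d [scd [hcd ->]]]].
exists (a ++ c), (b ++ d); split; first by rewrite !size_cat sab scd.
split.
  move=> i; rewrite size_cat !nth_cat -sab; case: (ltnP i (size a)) => hi hi'; first exact: hab.
  by apply: hcd; rewrite ltn_subLR.
rewrite size_cat big_split_ord /=; congr (_ + _); apply: eq_bigr => i _.
  by rewrite !nth_cat -sab ltn_ord.
by rewrite !nth_cat -sab ltnNge leq_addr /= addKn.
Qed.

Lemma mpow_mul_inm n (r x : R) : inm r -> mpow n x -> mpow n.+1 (r * x).
Proof.
move=> hr hx; exists [:: r], [:: x]; split=> //; split; last by rewrite big_ord1.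
by case.
Qed.

Lemma mpow_sum n I (s : seq I) (F : I -> R) :
  (forall i, mpow n (F i)) -> mpow n (\sum_(i <- s) F i).
Proof.
move=> h; elim: s => [|i s IH]; first by rewrite big_nil; apply: mpow0.
by rewrite big_cons; apply: mpowD.
Qed.

Lemma mpowM n (r x : R) : mpow n x -> mpow n (r * x).
Proof.
elim: n r x => [//|n IH] r x [a [b [sab [hab ->]]]].
rewrite mulr_sumr; apply: mpow_sum => i; rewrite mulrCA.
have [ha hb] := hab i (ltn_ord i).
by apply: mpow_mul_inm => //; apply: IH.
Qed.

Lemma mpow_ideal n : ideal (@mpow K R n).
Proof. by split; [exact: mpow0|split; [exact: mpowD|exact: mpowM]]. Qed.

Lemma mpow_lin n a (x y : R) : mpow n x -> mpow n y -> mpow n (a *: x + y).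
Proof.
by move=> hx hy; apply: mpowD => //; rewrite -mulr_algl; apply: mpowM.
Qed.

Lemma mpowS n (x : R) : mpow n.+1 x -> mpow n x.
Proof.
case=> [a [b [sab [hab ->]]]]; apply: mpow_sum => i.
by apply: mpowM; have [] := hab i (ltn_ord i).
Qed.

Lemma mpow_le n n' (x : R) : (n <= n')%N -> mpow n' x -> mpow n x.
Proof.
move=> /subnKC <-; elim: (n' - n)%N => [|d IH]; first by rewrite addn0.
by rewrite addnS => /mpowS.
Qed.

Lemma level_le n n' l : (n <= n')%N -> level n l -> level n' l.
Proof. by move=> le_n [h k]; split=> // r /(mpow_le le_n); apply: k. Qed.

Lemma level_shift n r l : level n l -> level n (shift r l).
Proof.
by move=> [h k]; split=> [|s hs]; [apply: Rlinear_shift|apply/k/mpowM].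
Qed.

(** Multiplication by an element of [m] carries [m^n] into [m^(n+1)]. This drop in level drives the
    inductions below. *)
Lemma level_shift_inm n r l : inm r -> level n.+1 l -> level n (shift r l).
Proof.
by move=> hr [h k]; split=> [|s hs]; [apply: Rlinear_shift|apply/k/mpow_mul_inm].
Qed.

Lemma isRd_shift r l : isRd l -> isRd (shift r l).
Proof. by move=> /isRd_level [n /level_shift h]; apply: level_isRd (h r). Qed.

Lemma isRd_lin a l1 l2 : isRd l1 -> isRd l2 -> isRd (fun r => a * l1 r + l2 r).
Proof.
move=> /isRd_level [n1 h1] /isRd_level [n2 h2].
apply: (@level_isRd (maxn n1 n2)); apply: level_lin.
  by apply: level_le h1; apply: leq_maxl.
by apply: level_le h2; apply: leq_maxr.
Qed.

Lemma shift_mpow_eq0 n r l : mpow n r -> level n l -> shift r l = fun=> 0.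
Proof.
by move=> hr [_ k]; apply/funext => s; apply: k; rewrite mulrC; apply: mpowM.
Qed.

Hypothesis paramR : @param_algebra K R.

Lemma isEps_ex : exists e, @isEps K R e.
Proof. by have [_ h _ _ _] := paramR; have [e he] := choice h; exists e. Qed.

Lemma inm0 : @inm K R 0.
Proof. by case=> s; rewrite mul0r => /esym/eqP; rewrite oner_eq0. Qed.

Lemma inmD (x y : R) : inm x -> inm y -> inm (x + y).
Proof. by have [h _ _ _ _] := paramR; apply: h. Qed.

Lemma inm_lin a (x y : R) : inm x -> inm y -> inm (a *: x + y).
Proof. by move=> hx hy; apply: inmD => //; rewrite -mulr_algl; apply: inmM. Qed.

Lemma inm_alg (k : K) : inm (k%:A : R) -> k = 0.
Proof.
move=> hk; have [//|nk] := eqVneq k 0; exfalso; apply: hk; exists (k^-1)%:A.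
by rewrite mulr_algl scalerA mulfV // scale1r.
Qed.

Lemma mpow1 (x : R) : mpow 1 x <-> inm x.
Proof.
split=> [[a [b [_ [h ->]]]]|hx]; last first.
  by rewrite -[x]mulr1; apply: mpow_mul_inm.
apply: (big_ind (@inm K R)); [exact: inm0|exact: inmD|move=> i _].
by rewrite mulrC; apply: inmM; have [] := h i (ltn_ord i).
Qed.

Variable e : R -> K.
Hypothesis heps : isEps e.

(** [isEps] does not state linearity; it follows from this uniqueness, which holds because [m]
    contains no nonzero scalar. *)
Lemma eps_unique x k : inm (x - k%:A) -> e x = k.
Proof.
move=> hk; apply/eqP; rewrite -subr_eq0; apply/eqP/inm_alg.
have := inm_lin (a := -1) (@heps x) hk; congr inm.
by rewrite scaleN1r opprB scalerBl addrA subrK.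
Qed.

Lemma eps_level : level 1 e.
Proof.
split=> [a x y|x /mpow1 hx]; last by apply: eps_unique; rewrite scale0r subr0.
apply: eps_unique; have := inm_lin (a := a) (@heps x) (@heps y); congr inm.
by rewrite scalerBr scalerDl scalerA opprD addrACA.
Qed.

Lemma eps_isRd : isRd e.
Proof. exact: level_isRd eps_level. Qed.

Lemma eps1 : e 1 = 1.
Proof. by apply: eps_unique; rewrite scale1r subrr; apply: inm0. Qed.

Lemma eps_inm x : inm x -> e x = 0.
Proof. by move=> hx; apply: eps_unique; rewrite scale0r subr0. Qed.

Lemma level1E l : level 1 l -> l = fun r => l 1 * e r.
Proof.
move=> [h k]; apply/funext => r; have /mpow1/k := @heps r.
by rewrite RlinearB // RlinearZ // => /eqP; rewrite subr_eq0 => /eqP ->; rewrite mulrC.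
Qed.

(* [1] and the [r i] span [R] over [K] modulo [W], with coordinates [e] and [lam i]. *)
Definition coords (W : R -> Prop) d (r : 'I_d -> R) (lam : 'I_d -> R -> K) : Prop :=
  [/\ forall i, inm (r i), forall i, Rlinear (lam i),
      forall i x, W x -> lam i x = 0 &
      forall x, W (x - (e x)%:A - \sum_i lam i x *: r i)].

Definition has_coords (W : R -> Prop) : Prop :=
  exists d (r : 'I_d -> R) (lam : 'I_d -> R -> K), coords W r lam.

Definition subspace (W : R -> Prop) : Prop :=
  W 0 /\ forall a x y, W x -> W y -> W (a *: x + y).

(** Coordinates modulo [W + K v] give coordinates modulo [W]: when [v] is outside [W], the remainder
    has a unique coefficient along [v], and uniqueness makes this coefficient linear. *)
Lemma coords_step (W : R -> Prop) (v : R) : subspace W ->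
  (forall x, W x -> inm x) -> inm v ->
  has_coords (fun x => exists a : K, W (x - a *: v)) -> has_coords W.
Proof.
move=> [W0 WD] Wm hv [d [r [lam [hr hl hk hc]]]].
have WW x : W x -> exists a : K, W (x - a *: v).
  by move=> Wx; exists 0; rewrite scale0r subr0.
have [Wv|nWv] := pselect (W v).
  exists d, r, lam; split=> // [i x /WW|x]; first exact: hk.
  have [a Wa] := hc x; have := WD a _ _ Wv Wa.
  by rewrite addrC subrK.
have [le _] := eps_level.
pose rho x := x - (e x)%:A - \sum_i lam i x *: r i.
have rhoE a x y : rho (a *: x + y) = a *: rho x + rho y.
  rewrite /rho le !scalerBr scaler_sumr [(_ + _)%:A]scalerDl scalerA.
  under eq_bigr do rewrite hl scalerDl -scalerA.
  by rewrite big_split /= !opprD [RHS]addrACA; congr (_ + _); rewrite addrACA.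
have [c cP] := choice hc; rewrite -/(rho _) in cP.
have c_uniq x b : W (rho x - b *: v) -> c x = b.
  move=> Wb; apply/eqP; rewrite -subr_eq0; apply/eqP.
  have [//|nz] := eqVneq (c x - b) 0; exfalso; apply: nWv.
  have := WD (- (c x - b)^-1) _ _ (WD (-1) _ _ Wb (cP x)) W0; congr W.
  rewrite addr0 scaleN1r opprB addrA subrK -scalerBl scalerA.
  by rewrite mulNr -mulrN opprB mulVf // scale1r.
(* Index [0] carries [v] and its coefficient; the old vectors and coordinates are shifted by one. *)
exists d.+1, (fun i => oapp r v (unlift ord0 i)),
  (fun i => oapp lam c (unlift ord0 i)); split.
- by move=> i; case: (unlift _ _).
- move=> i; case: (unlift _ _) => [j|] //=.
  move=> a x y; apply: c_uniq; have := WD a _ _ (cP x) (cP y); congr W.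
  by rewrite rhoE scalerBr scalerDl scalerA opprD addrACA.
- move=> i x Wx; case: (unlift _ _) => [j|] /=; first exact/hk/WW.
  apply: c_uniq; move: (Wx); congr W; rewrite /rho scale0r subr0 eps_inm; last exact: Wm.
  by rewrite scale0r subr0 big1 ?subr0 // => j _; rewrite hk ?scale0r //; apply: WW.
- move=> x; have := cP x; congr W; rewrite /rho big_ord_recl unlift_none /= opprD.
  rewrite [- (c x *: v) + _]addrC addrA; congr (_ - _ - _).
  by apply: eq_bigr => i _; rewrite liftK.
Qed.

Fixpoint add_span (W : R -> Prop) (vs : seq R) : R -> Prop :=
  if vs is v :: vs' then fun x => exists a : K, add_span W vs' (x - a *: v) else W.

Lemma coords_add_span (W : R -> Prop) (vs : seq R) : subspace W ->
  (forall x, W x -> inm x) -> (forall i, (i < size vs)%N -> inm vs`_i) ->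
  has_coords (add_span W vs) -> has_coords W.
Proof.
move=> sW Wm; elim: vs => [//|v vs IH] hvs hc.
have hvs' i : (i < size vs)%N -> inm vs`_i by move=> hi; apply: (hvs i.+1).
have hv : inm v by apply: (hvs 0%N).
apply: IH => //; apply: (coords_step (v := v)) => //.
  elim: vs {hc hvs hvs'} => [//|w vs [W0 WD]]; split.
    by exists 0; rewrite scale0r subr0.
  move=> a x y [b Wb] [c Wc]; exists (a * b + c); have := WD a _ _ Wb Wc.
  by congr add_span; rewrite scalerBr scalerDl scalerA opprD addrACA.
elim: vs hvs' {hc hvs} => [_|w vs IH hvs] x; first exact: Wm.
move=> [a] /IH h; rewrite -(subrK (a *: w) x) addrC; apply: inm_lin.
  by apply: (hvs 0%N).
by apply: h => i hi; apply: (hvs i.+1).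
Qed.

(** [R / m^(n+1)] is finite-dimensional, by induction on [n]. By noetherianity [m^(n+1)] has
    finitely many generators, and modulo [m^(n+2)] their coefficients matter only through residues,
    so [m^(n+1)] is [m^(n+2)] plus the [K]-span of the generators. *)
Lemma coords_mpow n : has_coords (mpow n.+1).
Proof.
elim: n => [|n IH].
  exists 0%N, (fun=> 0), (fun _ _ => 0); split=> [[]|[]|[]|x] //.
  by rewrite big_ord0 subr0; apply/mpow1.
have [_ _ noeth _ _] := paramR.
have [vs [hvs gen]] := noeth _ (mpow_ideal n.+1).
have in_m k (x : R) : mpow k.+1 x -> inm x.
  by move=> h; apply/mpow1; apply: mpow_le h.
apply: (coords_add_span (vs := vs)).
- by split; [exact: mpow0|move=> a x y; exact: mpow_lin].
- exact: in_m.
- by move=> i /hvs; apply: in_m.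
move: IH => [d [r [lam [hr hl hk hc]]]]; exists d, r, lam.
have span x : mpow n.+1 x -> add_span (mpow n.+2) vs x.
  move=> /gen [t [st ->]].
  have {gen}: forall ws us : seq R, size ws = size us ->
      (forall i, (i < size us)%N -> mpow n.+1 us`_i) ->
      add_span (mpow n.+2) us (\sum_(i < size us) ws`_i * us`_i).
    move=> ws us; elim: us ws => [|u us IH] [|w ws] //=.
      by rewrite big_ord0 => _ _; exact: (@mpow0 n.+2).
    move=> [sz] hus; exists (e w).
    have h0 : mpow n.+2 ((w - (e w)%:A) * u).
      by apply: mpow_mul_inm (@heps w) _; apply: (hus 0%N).
    have := IH ws sz (fun i hi => hus i.+1 hi); rewrite big_ord_recl /=.
    move: h0; rewrite mulrBl mulr_algl; set y := w * u - _.
    have -> z : w * u + z - e w *: u = y + z by rewrite addrAC.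
    elim: us {IH hus sz} (\sum_i _) => [|u' us IH] z hy /=.
      exact: (@mpowD n.+2).
    by move=> [a ha]; exists a; rewrite -addrA; apply: IH.
  by apply.
have sub x : add_span (mpow n.+2) vs x -> mpow n.+1 x.
  elim: vs hvs x {gen span} => [_|v vs IH] /= hvs x; first exact: (@mpowS n.+1).
  move=> [a] /IH h; rewrite -(subrK (a *: v) x) addrC; apply: mpow_lin.
    by apply: (hvs 0%N).
  by apply: h => i hi; apply: (hvs i.+1).
by split=> // [i x /sub|x]; [apply: hk|apply: span].
Qed.

Lemma coords_functional n d (r : 'I_d -> R) lam l : coords (mpow n) r lam ->
  level n l -> l = fun x => l 1 * e x + \sum_i l (r i) * lam i x.
Proof.
move=> [hr hl hk hc] [h k]; apply/funext => x.
have := k _ (hc x); rewrite !RlinearB // RlinearZ // Rlinear_sum //.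
move/eqP; rewrite -addrA -opprD subr_eq0 => /eqP ->.
rewrite mulrC; congr (_ + _); apply: eq_bigr => i _.
by rewrite RlinearZ // mulrC.
Qed.

End ParameterAlgebra.

(** * The completed tensor product and its [R]-linear operators *)

Section CompletedTensor.
Context {K : fieldType} {R C : comAlgType K}.
Implicit Types (p q : @Araw K R C) (l : R -> K) (h : @Araw K R C -> @Araw K R C).

Lemma isRd0 : @isRd K R (fun=> 0).
Proof.
apply: (@level_isRd _ _ 0); split=> [a x y|//].
by rewrite mulr0 addr0.
Qed.

Lemma isA_zero p : isA p -> p (fun=> 0) = 0.
Proof.
move=> hp; have := hp (-1) _ _ isRd0 isRd0.
by rewrite mulr0 addr0 scaleN1r addNr.
Qed.

Lemma isA_scalar p a l : isA p -> isRd l -> p (fun r => a * l r) = a *: p l.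
Proof.
move=> hp hl; have := hp a _ _ hl isRd0; rewrite isA_zero // addr0 => <-.
by congr p; apply/funext => r; rewrite addr0.
Qed.

Lemma isA_sum p I (s : seq I) (a : I -> K) (f : I -> R -> K) : isA p ->
  (forall i, isRd (f i)) ->
  isRd (fun r => \sum_(i <- s) a i * f i r) /\
  p (fun r => \sum_(i <- s) a i * f i r) = \sum_(i <- s) a i *: p (f i).
Proof.
move=> hp hf; elim: s => [|i s [IH1 IH2]].
  have -> : (fun r => \sum_(i <- [::]) a i * f i r) = fun=> 0.
    by apply/funext => r; rewrite big_nil.
  by split; [exact: isRd0|rewrite big_nil isA_zero].
have -> : (fun r => \sum_(i <- i :: s) a i * f i r) =
    fun r => a i * f i r + \sum_(i <- s) a i * f i r.
  by apply/funext => r; rewrite big_cons.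
by split; [exact: isRd_lin|rewrite hp // big_cons IH2].
Qed.

Lemma isA_iota c : isA (@iotaA K R C c).
Proof. by move=> a l1 l2 _ _; rewrite /iotaA scalerDl scalerA. Qed.

Lemma isA_add p q : isA p -> isA q -> isA (addA p q).
Proof. by move=> hp hq a l1 l2 h1 h2; rewrite /addA hp // hq // scalerDr addrACA. Qed.

Lemma isA_scale r p : isA p -> isA (scaleA r p).
Proof.
move=> hp a l1 l2 h1 h2; rewrite /scaleA.
exact: hp (isRd_shift r h1) (isRd_shift r h2).
Qed.

Lemma isA_opp p : isA p -> isA (fun l => - p l).
Proof. by move=> hp a l1 l2 h1 h2; rewrite hp // opprD scalerN. Qed.

Lemma isA_sub p q : isA p -> isA q -> isA (fun l => p l - q l).
Proof. by move=> hp /isA_opp; apply: isA_add. Qed.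

Lemma isA_bigsum I (s : seq I) (a : I -> @Araw K R C) :
  (forall i, isA (a i)) -> isA (fun l => \sum_(i <- s) a i l).
Proof.
move=> ha b l1 l2 h1 h2; rewrite scaler_sumr -big_split /=.
by apply: eq_bigr => i _; rewrite ha.
Qed.

(** Operators act on representatives, so they must respect [eqA]. Continuity in the [m]-adic sense
    is derived in [Rop_filtration]. *)
Definition Rop h : Prop :=
  [/\ forall p, isA p -> isA (h p),
      forall p q, isA p -> isA q -> eqA p q -> eqA (h p) (h q),
      forall p q, isA p -> isA q -> eqA (h (addA p q)) (addA (h p) (h q)) &
      forall r p, isA p -> eqA (h (scaleA r p)) (scaleA r (h p))].

Lemma Rop_zero h p l : Rop h -> isA p -> (forall l, isRd l -> p l = 0) ->
  isRd l -> h p l = 0.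
Proof.
move=> [hA hE hD hS] hp p0 hl.
rewrite (hE _ (scaleA 0 p)) //; first 1 last.
- exact: isA_scale.
- by move=> l' hl'; rewrite p0 // /scaleA p0 //; apply: (isRd_shift 0 hl').
rewrite hS // /scaleA; have -> : (fun s => l (0 * s)) = fun=> 0.
  by apply/funext => s; rewrite mul0r; apply: Rlinear0; have [] := hl.
by rewrite isA_zero //; apply: hA.
Qed.

Lemma Rop_sum h I (s : seq I) (r : I -> R) (a : I -> @Araw K R C) l :
  Rop h -> (forall i, isA (a i)) -> isRd l ->
  h (fun l => \sum_(i <- s) a i (shift (r i) l)) l =
  \sum_(i <- s) h (a i) (shift (r i) l).
Proof.
move=> hh ha hl; have [hA hE hD hS] := hh.
have hs t : isA (fun l => \sum_(i <- t) a i (shift (r i) l)).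
  by apply: (@isA_bigsum I t (fun i => scaleA (r i) (a i))) => i; apply: isA_scale.
elim: s => [|i s IH].
  by rewrite big_nil; apply: Rop_zero => // l' _; rewrite big_nil.
rewrite big_cons -IH.
have -> : h (a i) (shift (r i) l) = h (scaleA (r i) (a i)) l by rewrite hS.
rewrite -[RHS](hD _ _ _ _ l hl) //; last exact: isA_scale.
apply: hE => //; first by apply: isA_add => //; apply: isA_scale.
by move=> l' _; rewrite big_cons.
Qed.

Lemma Rop_klinear h l : Rop h -> isRd l -> klinear (fun c => h (iotaA c) l).
Proof.
move=> [hA hE hD hS] hl a x y.
rewrite (hE _ (addA (scaleA a%:A (iotaA x)) (iotaA y))) //; first 1 last.
- exact: isA_iota.
- by apply: isA_add; [apply/isA_scale/isA_iota|apply: isA_iota].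
- move=> l' [hl' _]; rewrite /addA /scaleA /iotaA mulr1 RlinearZ //.
  by rewrite scalerDr !scalerA [a * _]mulrC.
rewrite hD //; try by [apply/isA_scale/isA_iota|apply: isA_iota].
rewrite /addA hS //; last exact: isA_iota.
congr (_ + _); rewrite /scaleA -isA_scalar //; last exact/hA/isA_iota.
congr (h _); apply/funext => s; rewrite mulr_algl RlinearZ //.
by case: hl.
Qed.

Hypothesis paramR : @param_algebra K R.

(* The elements vanishing on all functionals that kill [m^n] form [m^n A]: [p] factors
   through [l |-> (l (r_i * _))_i], with [r_i] generating [m^n], and is extended linearly
   from the image of this map. *)
Lemma filtration_generated n p : isA p -> (forall l, level n l -> p l = 0) ->
  exists d (r : 'I_d -> R) (a : 'I_d -> @Araw K R C),
    [/\ forall i, mpow n (r i), forall i, isA (a i) &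
        forall l, isRd l -> p l = \sum_i a i (shift (r i) l)].
Proof.
move=> hp p0; have [_ _ noeth _ _] := paramR.
have [vs [hvs gen]] := noeth _ (mpow_ideal n).
pose d := size vs; pose r (i : 'I_d) := vs`_i.
pose V := 'I_d -> R -> K^o.
pose Phi l : V := fun i => shift (r i) l.
pose G0 : set (V * C) := [set x | exists l, [/\ isRd l, x.1 = Phi l & x.2 = p l]]%classic.
have [|F [lF hF]] := @lin_graph_ext K V C G0.
  split.
  - exists (fun=> 0); split; [exact: isRd0|by []|by rewrite isA_zero].
  - move=> a [x1 x2] [y1 y2] [l1 [h1 /= -> ->]] [l2 [h2 /= -> ->]].
    by exists (fun r => a * l1 r + l2 r); split; [exact: isRd_lin| |rewrite hp].
  (* Well-definedness: if every [shift (r i) l] vanishes, then [l] kills the ideal generated by the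
     [r i], which is [m^n], and [p] vanishes at [l]. *)
  - move=> w [l [hl /= Phi0 ->]]; apply: p0; split; first by case: hl.
    move=> x /gen [t [_ ->]]; rewrite Rlinear_sum; last by case: hl.
    apply: big1 => i _; rewrite mulrC.
    by have := congr1 (fun f : V => f i t`_i) Phi0; rewrite /Phi /shift => <-.
pose delta (i : 'I_d) l : V := fun j => if j == i then l else fun=> 0.
exists d, r, (fun i l => F (delta i l)); split.
- by move=> i; apply: hvs.
- move=> i a l1 l2 _ _; rewrite -lF; congr F; apply/funext => j; apply/funext => s.
  rewrite [RHS]/(a * delta i l1 j s + delta i l2 j s) /delta.
  by case: ifP => // _; rewrite mulr0; apply/esym/addr0.
move=> l hl; rewrite -(hF (Phi l) (p l)); last by exists l.
rewrite -klinear_sum //; congr F; apply/funext => j; apply/funext => s.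
rewrite !fct_sumE (bigD1 j) //= /delta eqxx big1 ?addr0 // => i.
by rewrite eq_sym => /negPf ->.
Qed.

(** [p] is a sum of [r_i a_i] with [r_i] in [m^n], so [h p] is the sum of the [r_i h(a_i)], and [l]
    shifted by [r_i] is zero. *)
Lemma Rop_filtration h n p l : Rop h -> isA p ->
  (forall l, level n l -> p l = 0) -> level n l -> h p l = 0.
Proof.
move=> hh hp p0 hl; have [d [r [a [hr ha pE]]]] := filtration_generated hp p0.
have hl' := level_isRd hl; have [hA hE hD hS] := hh.
have ha' i : isA (scaleA (r i) (a i)) by apply: isA_scale.
rewrite (hE p (fun l => \sum_i scaleA (r i) (a i) l)) //; last exact: isA_bigsum.
rewrite (Rop_sum _ _ hh) //; apply: big1 => i _.
by rewrite (shift_mpow_eq0 (hr i) hl) isA_zero //; apply: hA.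
Qed.

Variable e : R -> K.
Hypothesis heps : isEps e.

Lemma lam_level n d (r : 'I_d -> R) lam i : coords e (mpow n) r lam -> level n (lam i).
Proof. by move=> [_ hl hk _]; split=> // x; apply: hk. Qed.

Lemma lam_isRd n d (r : 'I_d -> R) lam i : coords e (mpow n) r lam -> isRd (lam i).
Proof. by move=> /lam_level h; apply: level_isRd (h i). Qed.

Lemma isA_coords n d (r : 'I_d -> R) lam p l : coords e (mpow n) r lam ->
  level n l -> isA p -> p l = l 1 *: p e + \sum_i l (r i) *: p (lam i).
Proof.
move=> hc hl hp; rewrite [in LHS](coords_functional hc hl).
have [h1 h2] := isA_sum (index_enum _) (fun i => l (r i)) hp (fun i => lam_isRd i hc).
by rewrite hp ?h2 //; apply: (eps_isRd paramR heps).
Qed.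

(** Modulo [m^n A], [p] is the sum of [1 (x) p e] and the [r_i (x) p (lam i)], and [Rop_filtration]
    allows [h] to be evaluated on this sum. Hence the restriction of [h] to [C] determines [h]. *)
Lemma Rop_expand n d (r : 'I_d -> R) lam h p l : coords e (mpow n) r lam ->
  Rop h -> isA p -> level n l ->
  h p l = h (iotaA (p e)) l + \sum_i h (iotaA (p (lam i))) (shift (r i) l).
Proof.
move=> hc hh hp hl; have [hA hE hD hS] := hh; have hl' := level_isRd hl.
pose b : @Araw K R C := fun l => \sum_i iotaA (p (lam i)) (shift (r i) l).
have hb : isA b.
  by apply: (@isA_bigsum _ _ (fun i => scaleA (r i) (iotaA (p (lam i))))) => i;
    apply/isA_scale/isA_iota.
pose c := addA (iotaA (p e)) b.
have hcA : isA c by apply: isA_add => //; apply: isA_iota.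
have hq : isA (fun l => p l - c l) by apply: isA_sub.
rewrite (hE p (addA c (fun l => p l - c l))) //; last 2 first.
- exact: isA_add.
- by move=> l' _; rewrite /addA [c l' + _]addrC subrK.
rewrite hD // {1}/addA (Rop_filtration hh hq _ hl); last first.
  move=> l' hl2; rewrite (isA_coords hc hl2 hp) /c /addA /b /iotaA.
  apply/eqP; rewrite subr_eq0; apply/eqP; congr (_ + _).
  by apply: eq_bigr => i _; rewrite /shift mulr1.
rewrite addr0 hD //; last exact: isA_iota.
congr (_ + _); apply: (Rop_sum _ _ hh) => // i; exact: isA_iota.
Qed.

(* The same expansion with the roles of [h] and [p] exchanged: both are the contraction of
   [(r, s) |-> l (r * s)] with the two coordinate systems. *)
Lemma Rop_expand_sym n d (r : 'I_d -> R) lam h p l : coords e (mpow n) r lam ->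
  Rop h -> isA p -> level n l ->
  h p l = h (iotaA (p l)) e + \sum_i h (iotaA (p (shift (r i) l))) (lam i).
Proof.
move=> hc hh hp hl; have [hA hE hD hS] := hh.
have hiA c : isA (h (iotaA c)) by apply/hA/isA_iota.
have lin l' (h' : isRd l') := Rop_klinear hh h'.
have re := eps_isRd paramR heps.
rewrite (Rop_expand hc hh hp hl).
rewrite (isA_coords hc hl (hiA _)) [in RHS](isA_coords hc hl hp).
rewrite (lin e re) (klinear_sum (f := fun c => h (iotaA c) e)); last exact: lin.
under [X in _ + X = _]eq_bigr => i _.
  rewrite (isA_coords hc (level_shift (r i) hl) (hiA _)) {1}/shift mulr1.
  over.
under [X in _ = _ + X]eq_bigr => i _.
  rewrite (isA_coords hc (level_shift (r i) hl) hp) {1}/shift mulr1.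
  rewrite (lin _ (lam_isRd i hc)).
  rewrite (klinear_sum (f := fun c => h (iotaA c) (lam i))); last first.
    exact/lin/lam_isRd/hc.
  over.
rewrite !big_split /= -!addrA; congr (_ + _).
rewrite addrCA; congr (_ + (_ + _)).
- apply: eq_bigr => i _; by rewrite (klinearZ (f := fun c => h (iotaA c) e)) //; apply: lin.
- rewrite exchange_big; apply: eq_bigr => i _; apply: eq_bigr => j _.
  rewrite (klinearZ (f := fun c => h (iotaA c) (lam i))); last exact/lin/lam_isRd/hc.
  by rewrite /shift mulrC.
Qed.

End CompletedTensor.

(** * Differential dependence of star products, one functional at a time *)

Section DifferentialFamilies.
Context {K : fieldType} {R C : comAlgType K}.
Local Notation A := (@Araw K R C).
Hypothesis paramR : @param_algebra K R.

Lemma iota_eps (c : C) (e : R -> K) : isEps e -> iotaA c e = c :> C.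
Proof. by move=> he; rewrite /iotaA (eps1 paramR he) scale1r. Qed.

(** [Rop_expand] makes this a finite sum of compositions, with coordinates independent of [x] and
    hence uniform order. Assuming differentiability only up to level [n+1] keeps the lemma usable
    inside inductions on the level. *)
Lemma unif_diff_Rop X (H : X -> A -> A) (P : X -> C -> A) n l :
  (forall x, Rop (H x)) -> (forall x c, isA (P x c)) ->
  (forall l, level n.+1 l -> unif_diff (fun x c => H x (iotaA c) l)) ->
  (forall l, level n.+1 l -> unif_diff (fun x c => P x c l)) ->
  level n.+1 l -> unif_diff (fun x c => H x (P x c) l).
Proof.
move=> hH hP dH dP hl; have [e he] := isEps_ex paramR.
have [d [r [lam hc]]] := coords_mpow paramR he n.
have le := level_le (ltn0Sn n) (eps_level paramR he).
apply: (@unif_diff_eq _ _ _ (fun x c => H x (iotaA (P x c e)) l +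
    \sum_i H x (iotaA (P x c (lam i))) (shift (r i) l))).
  by move=> x c; rewrite [RHS](Rop_expand paramR he hc).
apply: unif_diffD; first exact: (unif_diff_comp (dH _ hl) (dP _ le)).
apply: unif_diff_sum => i.
exact: (unif_diff_comp (dH _ (level_shift (r i) hl)) (dP _ (lam_level i hc))).
Qed.

(** Expanding [p x] leaves finitely many components in [C], along which the family of [B] is merely
    reindexed; so [p] may depend on [x] arbitrarily. *)
Lemma unif_diff_bilinear X (B : A -> A -> A) (p : X -> A) l :
  (forall c, Rop (fun q => B q (iotaA c))) ->
  (forall l, isRd l -> unif_diff (fun x y => B (iotaA x) (iotaA y) l)) ->
  (forall x, isA (p x)) -> isRd l ->
  unif_diff (fun x c => B (p x) (iotaA c) l).
Proof.
move=> hB dB hp /isRd_level [n /(level_le (leqnSn n)) hl].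
have [e he] := isEps_ex paramR.
have [d [r [lam hc]]] := coords_mpow paramR he n.
apply: (@unif_diff_eq _ _ _ (fun x c => B (iotaA (p x e)) (iotaA c) l +
    \sum_i B (iotaA (p x (lam i))) (iotaA c) (shift (r i) l))).
  by move=> x c; rewrite [RHS](Rop_expand paramR he hc (hB c)).
apply: unif_diffD.
  exact: (unif_diff_reindex (fun x => p x e) (dB _ (level_isRd hl))).
apply: unif_diff_sum => i.
exact: (unif_diff_reindex (fun x => p x (lam i))
  (dB _ (level_isRd (level_shift (r i) hl)))).
Qed.

Lemma star_RopR (st : A -> A -> A) p : star_product st -> isA p -> Rop (st p).
Proof.
move=> [sA [sE [sD [sS _]]]] hp; split.
- by move=> q; apply: sA.
- by move=> q q' hq hq' qq'; apply: sE.
- by move=> q q' hq hq'; have [] := sD _ _ _ hq hq' hp.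
- by move=> r q hq; have [] := sS r _ _ hp hq.
Qed.

Lemma star_RopL (st : A -> A -> A) q : star_product st -> isA q ->
  Rop (fun p => st p q).
Proof.
move=> [sA [sE [sD [sS _]]]] hq; split.
- by move=> p hp; apply: sA.
- by move=> p p' hp hp' pp'; apply: sE.
- by move=> p p' hp hp'; have [] := sD _ _ _ hp hp' hq.
- by move=> r p hp; have [] := sS r _ _ hp hq.
Qed.

(** Expanding [p] in coordinates, the terms other than that of [p e] are evaluated at [e] shifted by
    an element of [m], which is zero. *)
Lemma star_eps (st : A -> A -> A) p c e : star_product st -> isEps e -> isA p ->
  st p (iotaA c) e = p e * c.
Proof.
move=> hst he hp; have [d [r [lam hc]]] := coords_mpow paramR he 0.
have le := eps_level paramR he.
rewrite (Rop_expand paramR he hc (star_RopL hst (isA_iota c)) hp le).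
have [sA [_ [_ [_ [_ [_ sEps]]]]]] := hst; rewrite sEps // big1 ?addr0 // => i _.
have [hr _ _ _] := hc.
rewrite (level0_eq (level_shift_inm (hr i) le)) isA_zero //.
by apply: sA; apply: isA_iota.
Qed.

Lemma unif_diff_mul X (f : X -> C) : unif_diff (fun x c => f x * c).
Proof.
exists 0%N => x; split=> [a y z|a y]; last by rewrite mulrCA.
by rewrite mulrDr scalerAr.
Qed.

Lemma diff_star_unif (st : A -> A -> A) l : diff_star st -> isRd l ->
  unif_diff (fun x y => st (iotaA x) (iotaA y) l) /\
  unif_diff (fun y x => st (iotaA x) (iotaA y) l).
Proof.
move=> [om [_ _ omD stE]] hl; have [lin [[k hk] _]] := omD _ hl.
split.
- apply: (@unif_diff_eq _ _ _ (fun x y => l 1 *: (x * y) + om l x y)).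
    by move=> x y; rewrite stE.
  apply: unif_diff_lin; first exact: (unif_diff_mul id).
  by exists k => x; split; [case: (lin x) | case: (hk x)].
- apply: (@unif_diff_eq _ _ _ (fun y x => l 1 *: (y * x) + om l x y)).
    by move=> y x; rewrite stE // [y * x]mulrC.
  apply: unif_diff_lin; first exact: (unif_diff_mul id).
  by exists k => x; split; [case: (lin x) | case: (hk x)].
Qed.

(** The condition is on the components of [h] itself, not on a logarithm; for a gauge transformation
    it is proved equivalent to [diff_gauge] and serves as the intermediate notion. *)
Definition differential (h : A -> A) : Prop :=
  forall l, isRd l -> diffop (fun c => h (iotaA c) l).

(** * Gauge transformations: their components, logarithm and inverse *)

Section Gauge.
Variable g : A -> A.
Hypothesis gaugeg : gauge g.

Lemma gauge_Rop : Rop g.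
Proof. by have [gA [gE [gD [gS _]]]] := gaugeg; split. Qed.

Lemma gauge_eps p e : isA p -> isEps e -> g p e = p e.
Proof. by have [_ [_ [_ [_ [_ [h _]]]]]] := gaugeg; apply: h. Qed.

Lemma gauge_differential (st st' : A -> A -> A) :
  star_product st -> star_product st' ->
  (forall a1 a2, isA a1 -> isA a2 -> eqA (g (st a1 a2)) (st' (g a1) (g a2))) ->
  diff_star st -> diff_star st' -> differential g.
Proof.
move=> hst hst' hom dst dst' l /isRd_level [n].
have gR := gauge_Rop; have [gA _ _ _] := gR; have [e he] := isEps_ex paramR.
have giA c : isA (g (iotaA c)) by apply/gA/isA_iota.
have [sA [_ [_ [_ [_ [_ sEps]]]]]] := hst.
have stA x y : isA (st (iotaA x) (iotaA y)) by apply: sA; apply: isA_iota.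
elim: n l => [|n IH] l hl.
  apply/diffopP; apply: unif_diff_eq (@unif_diff0 _ _ _) => _ c.
  by rewrite (level0_eq hl) isA_zero.
have hl' := level_isRd hl.
apply: diffop_of_comm; first exact: Rop_klinear gR hl'.
have [d [r [lam hc]]] := coords_mpow paramR he n; have [hr _ _ _] := hc.
(* Both sides of the homomorphism identity are expanded at [l]: the [e]-terms are [g_l (x y)] and
   [x (g_l y)]; in the other terms, [g] is applied to an argument depending on [y] only at
   [shift (r i) l], which has level [n]. *)
have comm x y : g (iotaA (x * y)) l - x * g (iotaA y) l =
    \sum_i st' (g (iotaA x)) (iotaA (g (iotaA y) (shift (r i) l))) (lam i) -
    \sum_i g (iotaA (st (iotaA x) (iotaA y) (lam i))) (shift (r i) l).
  have := hom _ _ (isA_iota x) (isA_iota y) l hl'.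
  rewrite (Rop_expand paramR he hc gR (stA x y) hl) sEps //.
  rewrite (Rop_expand_sym paramR he hc (star_RopR hst' (giA x)) (giA y) hl).
  rewrite star_eps // (gauge_eps (isA_iota x) he).
  rewrite iota_eps // => E.
  by rewrite -[g _ l](addrK (\sum_i g (iotaA (st (iotaA x) (iotaA y) (lam i)))
    (shift (r i) l))) E addrAC [x * _ + _]addrC addrK.
apply: (unif_diff_eq (fun x y => esym (comm x y))).
have gd i X : unif_diff (fun (_ : X) y => g (iotaA y) (shift (r i) l)).
  have /diffopP h := IH _ (level_shift_inm (hr i) hl).
  exact: (unif_diff_reindex (fun _ : X => tt) h).
apply: unif_diffB; apply: unif_diff_sum => i.
  (* [x] is only a parameter here, so [g (iotaA x)] may be any element of [A]. *)
  have dB : unif_diff (fun x c => st' (g (iotaA x)) (iotaA c) (lam i)).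
    apply: unif_diff_bilinear => //; last exact: lam_isRd hc.
      by move=> c; apply/star_RopL/isA_iota.
    by move=> l1 h1; case: (diff_star_unif dst' h1).
  exact: (unif_diff_comp dB (gd i C)).
have [dB _] := diff_star_unif dst (lam_isRd i hc).
exact: (unif_diff_comp (gd i C) dB).
Qed.

Lemma gm1_Rop : Rop (gm1 g).
Proof.
have [gA gE gD gS] := gauge_Rop; split.
- by move=> p hp; apply: isA_sub => //; apply: gA.
- by move=> p q hp hq pq l hl; rewrite /gm1 (gE p q) // pq.
- by move=> p q hp hq l hl; rewrite /addA /gm1 gD // opprD addrACA.
- by move=> r p hp l hl; rewrite /gm1 gS.
Qed.

Lemma gm1_eps p e : isA p -> isEps e -> gm1 g p e = 0.
Proof. by move=> hp he; rewrite /gm1 gauge_eps // subrr. Qed.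

Lemma iter_gm1_isA k p : isA p -> isA (iter k (gm1 g) p).
Proof. by move=> hp; elim: k => //= k IH; have [h _ _ _] := gm1_Rop; apply: h. Qed.

(** [gm1 g] maps [A] into [m A], so its [k]-th power lands in [m^k A], where functionals of level
    [k] vanish. This makes the logarithm a finite sum at each functional. *)
Lemma iter_gm1_eq0 k p l : isA p -> level k l -> iter k (gm1 g) p l = 0.
Proof.
move=> hp; elim: k l => [|k IH] l hl; first by rewrite (level0_eq hl) isA_zero.
have [e he] := isEps_ex paramR.
have [d [r [lam hc]]] := coords_mpow paramR he k; have [hr _ _ _] := hc.
rewrite iterS (Rop_expand_sym paramR he hc gm1_Rop (iter_gm1_isA k hp) hl).
rewrite gm1_eps //; last exact: isA_iota.
rewrite big1 ?addr0 // => i _; rewrite IH; last exact: level_shift_inm.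
apply: (klinear0 (f := fun c => gm1 g (iotaA c) (lam i))).
exact: Rop_klinear gm1_Rop (lam_isRd i hc).
Qed.

Lemma unif_diff_iter_gm1 n k l :
  (forall l, level n.+1 l -> diffop (fun c => gm1 g (iotaA c) l)) ->
  level n.+1 l -> unif_diff (fun (_ : unit) c => iter k (gm1 g) (iotaA c) l).
Proof.
move=> dN; elim: k l => [|k IH] l hl /=.
  exact: (unif_diffZ (l 1) (@unif_diff_id _ _ _)).
apply: (@unif_diff_Rop unit (fun=> gm1 g) (fun=> fun c => iter k (gm1 g) (iotaA c)) n) => //.
- by move=> _; exact: gm1_Rop.
- by move=> _ c; apply/iter_gm1_isA/isA_iota.
- by move=> l1 /dN /diffopP.
Qed.

Lemma gm1_differentialE : differential (gm1 g) <-> differential g.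
Proof.
split=> h l hl; apply/diffopP; have /diffopP hd := h l hl.
  apply: unif_diff_eq (unif_diffD hd (unif_diffZ (l 1) (@unif_diff_id _ _ _))) => _ c.
  by rewrite /gm1 /iotaA subrK.
exact: unif_diffB hd (unif_diffZ (l 1) (@unif_diff_id _ _ _)).
Qed.

Lemma differential_diff_gauge : differential g -> diff_gauge g.
Proof.
move=> /gm1_differentialE dN.
pose S n (c : C) (l : R -> K) :=
  \sum_(1 <= k < n.+1) (((-1) ^+ k.+1 / k%:R) *: iter k (gm1 g) (iotaA c) l).
have itA k c : isA (iter k (gm1 g) (iotaA c)) by apply/iter_gm1_isA/isA_iota.
have S_stable n n' c l : (n <= n')%N -> level n l -> S n' c l = S n c l.
  move=> le_n hl; rewrite /S (big_cat_nat (n := n.+1)) //=.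
  rewrite [X in _ + X = _]big_nat [X in _ + X = _]big1 ?addr0 // => k /andP [hk _].
  rewrite iter_gm1_eq0 ?scaler0 //; first exact: isA_iota.
  by apply: level_le hl; apply: ltnW.
have SE n n' c l : level n l -> level n' l -> S n c l = S n' c l.
  move=> hn hn'; have [le_n|/ltnW le_n] := leqP n n'; first exact/esym/S_stable.
  exact: S_stable.
(* Any admissible level gives the same truncated sum, so [G] is well defined; outside the continuous
   functionals zero is available as a value. *)
have exG l : exists Gl : C -> C, forall n, level n l -> forall c, Gl c = S n c l.
  have [/isRd_level [n hn]|nl] := pselect (isRd l).
    by exists (fun c => S n c l) => n' hn' c; apply: SE.
  by exists (fun=> 0) => n /level_isRd.
have [G hG] := choice exG; exists G; split.
- move=> a l1 l2 /isRd_level [n1 h1] /isRd_level [n2 h2].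
  have {}h1 := level_le (leq_maxl n1 n2) h1.
  have {}h2 := level_le (leq_maxr n1 n2) h2.
  apply/funext => c; rewrite (hG _ _ (level_lin a h1 h2)) (hG _ _ h1) (hG _ _ h2).
  rewrite /S scaler_sumr -big_split /=; apply: eq_bigr => k _.
  rewrite (itA k c a _ _ (level_isRd h1) (level_isRd h2)).
  by rewrite scalerDr !scalerA [a * _]mulrC.
- move=> e he c; rewrite (hG _ _ (eps_level paramR he)) /S big_nat1 /=.
  by rewrite gm1_eps ?scaler0 //; apply: isA_iota.
- move=> l /isRd_level [n hn]; split.
    apply/diffopP; apply: (@unif_diff_eq _ _ _ (fun=> fun c => S n c l)).
      by move=> _ c; rewrite (hG _ _ hn).
    apply: unif_diff_sum => k; apply: unif_diffZ.
    apply: (@unif_diff_iter_gm1 n); last exact: level_le hn.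
    by move=> l' /level_isRd; apply: dN.
  rewrite (hG _ _ hn) /S big_nat big1 // => -[//|k] _.
  (* Every term of the series has positive degree, and its innermost factor [gm1 g] already
     annihilates the unit. *)
  rewrite iterSr; suff -> : iter k (gm1 g) (gm1 g (iotaA 1)) l = 0 by rewrite scaler0.
  have nA : isA (gm1 g (iotaA 1)) by apply: (itA 1%N).
  elim: k l {n hn} (level_isRd hn) => [|k IH] l hl /=.
    have [_ [_ [_ [_ [_ [_ g1]]]]]] := gaugeg.
    by rewrite /gm1 g1 // subrr.
  by apply: (Rop_zero gm1_Rop) => //; apply: iter_gm1_isA.
- move=> c l n hl kl; rewrite (hG _ n) //; split=> //; by case: hl.
Qed.

(* Both [p] and [gm1 g] vanish at [e], so [l] is only evaluated on [m^2], where coordinates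
   modulo [m^(n+1)] determine it. *)
Lemma gm1_expand_low n d (r : 'I_d -> R) lam p l e : isEps e ->
  coords e (mpow n.+1) r lam -> isA p -> p e = 0 -> level n.+2 l ->
  gm1 g p l = \sum_i gm1 g (iotaA (p (shift (r i) l))) (lam i).
Proof.
move=> he hc hp pe hl.
have [D [r' [lam' hc']]] := coords_mpow paramR he n.+1; have [hr' _ _ _] := hc'.
have [NA _ _ _] := gm1_Rop.
have lin l' (h : isRd l') := Rop_klinear gm1_Rop h.
rewrite (Rop_expand paramR he hc' gm1_Rop hp hl) pe.
rewrite (klinear0 (f := fun c => gm1 g (iotaA c) l)) ?add0r; last exact/lin/level_isRd/hl.
under [LHS]eq_bigr => i _.
  rewrite (isA_coords paramR he hc (level_shift_inm (hr' i) hl)); last exact/NA/isA_iota.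
  rewrite gm1_eps // ?scaler0 ?add0r; last exact: isA_iota.
  over.
rewrite exchange_big; apply: eq_bigr => i _.
rewrite (isA_coords paramR he hc' (level_shift (r i) hl) hp) pe scaler0 add0r.
rewrite (klinear_sum (f := fun c => gm1 g (iotaA c) (lam i))); last exact/lin/lam_isRd/hc.
apply: eq_bigr => j _.
rewrite (klinearZ (f := fun c => gm1 g (iotaA c) (lam i))); last exact/lin/lam_isRd/hc.
by rewrite /shift mulrC.
Qed.

Lemma diff_gauge_differential : diff_gauge g -> differential g.
Proof.
move=> [G [_ _ dG GE]]; apply/gm1_differentialE => l /isRd_level [n hn].
(* The level is taken positive: the base case then consists of multiples of [e], where [gm1 g]
   vanishes, and coordinates exist for each power used. *)
have {n hn}[n hl] : exists n, level n.+1 l by exists n; apply: level_le hn.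
have [e he] := isEps_ex paramR; have [NA _ _ _] := gm1_Rop.
elim: n l hl => [|n IH] l hl.
  apply/diffopP; apply: unif_diff_eq (@unif_diff0 _ _ _) => _ c.
  rewrite (level1E paramR he hl) isA_scalar; first 1 last.
  - exact/NA/isA_iota.
  - exact: (eps_isRd paramR he).
  by rewrite gm1_eps ?scaler0 //; apply: isA_iota.
have hl' := level_isRd hl; have [_ kl] := hl.
have [/diffopP dGl _] := dG l hl'; apply/diffopP.
(* Degrees [2] to [n+2] of the series are reindexed from [0]; hence the sign exponent [k+3] and the
   denominator [k+2]. *)
apply: (@unif_diff_eq _ _ _ (fun=> fun c => G l c -
  \sum_(0 <= k < n.+1) (((-1) ^+ k.+3 / k.+2%:R) *: iter k.+2 (gm1 g) (iotaA c) l))).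
  move=> _ c; rewrite (GE c l n.+2) // big_nat_recl //= big_add1 /=.
  by rewrite expr2 mulrNN mulr1 invr1 mulr1 scale1r addrK.
apply: unif_diffB dGl _; apply: unif_diff_sum => k; apply: unif_diffZ.
(* Coordinates modulo [m^(n+1)], one power less than the level of [l], keep both factors at level
   [n+1], where the induction hypothesis applies. *)
have [d [r [lam hc]]] := coords_mpow paramR he n.
apply: (@unif_diff_eq _ _ _ (fun=> fun c =>
    \sum_i gm1 g (iotaA (iter k.+1 (gm1 g) (iotaA c) (shift (r i) l))) (lam i))).
  move=> _ c; have itA j := iter_gm1_isA j (isA_iota (K := K) (R := R) c).
  apply/esym/(gm1_expand_low he hc (itA k.+1)) => //.
  by rewrite iterS gm1_eps.
apply: unif_diff_sum => i; have [hr _ _ _] := hc.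
have /IH/diffopP dN := lam_level i hc.
exact: (unif_diff_comp dN (unif_diff_iter_gm1 k.+1 IH (level_shift_inm (hr i) hl))).
Qed.

(** As [g] is the identity modulo [m], expanding [g (P c) = c] at [l] isolates [P c l]; the
    remaining terms use [P] only at lower level. *)
Lemma inverse_differential (P : C -> A) : differential g ->
  (forall c, isA (P c)) -> (forall c, eqA (g (P c)) (iotaA c)) ->
  forall l, isRd l -> diffop (fun c => P c l).
Proof.
move=> dg hP gP l /isRd_level [n]; have [e he] := isEps_ex paramR.
elim: n l => [|n IH] l hl.
  apply/diffopP; apply: unif_diff_eq (@unif_diff0 _ _ _) => _ c.
  by rewrite (level0_eq hl) isA_zero.
have [d [r [lam hc]]] := coords_mpow paramR he n; have [hr _ _ _] := hc.
apply/diffopP; apply: (@unif_diff_eq _ _ _ (fun=> fun c =>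
    l 1 *: c - \sum_i g (iotaA (P c (shift (r i) l))) (lam i))).
  move=> _ c; have := gP c l (level_isRd hl).
  rewrite (Rop_expand_sym paramR he hc gauge_Rop (hP c) hl).
  rewrite (gauge_eps (isA_iota _) he) iota_eps // => E.
  by rewrite -[l 1 *: c]E addrK.
apply: unif_diffB; first exact: unif_diffZ (@unif_diff_id _ _ _).
apply: unif_diff_sum => i; have /diffopP dP := IH _ (level_shift_inm (hr i) hl).
have /diffopP dgi := dg _ (lam_isRd i hc).
exact: (unif_diff_comp dgi dP).
Qed.

Lemma gauge_diff_star (st st' : A -> A -> A) :
  star_product st -> star_product st' ->
  (forall a1 a2, isA a1 -> isA a2 -> eqA (g (st a1 a2)) (st' (g a1) (g a2))) ->
  diff_star st -> differential g -> diff_star st'.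
Proof.
move=> hst hst' hom dst dg.
have [gA _ _ _] := gauge_Rop.
have [_ [_ [_ [_ [[ginv [ginvA ginvK]] _]]]]] := gaugeg.
pose P c := ginv (iotaA c).
have PA c : isA (P c) by apply/ginvA/isA_iota.
have gP c : eqA (g (P c)) (iotaA c).
  by have [] := ginvK _ (isA_iota (K := K) (R := R) c).
have dP X l : isRd l -> unif_diff (fun (_ : X) c => P c l).
  move=> /(inverse_differential dg PA gP) /diffopP h.
  exact: (unif_diff_reindex (fun _ : X => tt) h).
have [sA [sE [sD [sS [sAs [s1 sEps]]]]]] := hst.
have [sA' [sE' [sD' [sS' [sAs' [s1' sEps']]]]]] := hst'.
have stE x y l : isRd l -> st' (iotaA x) (iotaA y) l = g (st (P x) (P y)) l.
  move=> hl; rewrite hom //; apply: sE' => //; try exact: isA_iota; try exact: gA.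
    by move=> l' hl'; rewrite gP.
  by move=> l' hl'; rewrite gP.
(* Stated for a general [B] so that it applies to [st] and to its opposite, which gives
   differentiability in either argument. *)
have transfer (B : A -> A -> A) : (forall p, isA p -> Rop (B p)) ->
    (forall q, isA q -> Rop (fun p => B p q)) ->
    (forall l, isRd l -> unif_diff (fun x y => B (iotaA x) (iotaA y) l)) ->
    forall l, isRd l -> unif_diff (fun x y => g (B (P x) (P y)) l).
  move=> BR BL dB l /isRd_level [n hn]; have hl := level_le (leqnSn n) hn.
  have BA x y : isA (B (P x) (P y)) by have [h _ _ _] := BR _ (PA x); apply: h.
  apply: (@unif_diff_Rop C (fun=> g) (fun x y => B (P x) (P y)) n) => //.
  - by move=> _; exact: gauge_Rop.
  - move=> l1 /level_isRd /dg /diffopP h.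
    exact: (unif_diff_reindex (fun _ : C => tt) h).
  move=> l1 h1; apply: (@unif_diff_Rop C (fun x => B (P x)) (fun=> P) n) => //.
  - by move=> x; apply: BR.
  - move=> l2 /level_isRd h2; apply: (unif_diff_bilinear (B := B)) => // c.
    exact/BL/isA_iota.
  - by move=> l2 /level_isRd; apply: dP.
have bdiff l : isRd l -> unif_diff (fun x y => st' (iotaA x) (iotaA y) l) /\
    unif_diff (fun y x => st' (iotaA x) (iotaA y) l).
  move=> hl; split.
    apply: (unif_diff_eq (fun x y => esym (stE x y l hl))).
    apply: (transfer st) hl.
    - by move=> p; apply: star_RopR.
    - by move=> q; apply: star_RopL.
    - by move=> l1 h1; case: (diff_star_unif dst h1).
  apply: (unif_diff_eq (fun y x => esym (stE x y l hl))).
  apply: (transfer (fun p q => st q p)) hl.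
  - by move=> p; apply: star_RopL.
  - by move=> q; apply: star_RopR.
  - by move=> l1 h1; case: (diff_star_unif dst h1).
exists (fun l x y => st' (iotaA x) (iotaA y) l - l 1 *: (x * y)); split.
- move=> a l1 l2 h1 h2; apply/funext => x; apply/funext => y.
  have -> // := sA' _ _ (isA_iota x) (isA_iota y).
  by rewrite scalerDl opprD addrACA scalerBr scalerA.
- by move=> e he x y; rewrite sEps' // (eps1 paramR he) scale1r subrr.
- move=> l hl; have [b1 b2] := bdiff l hl.
  have /[dup] m1 : unif_diff (fun x y : C => l 1 *: (x * y)).
    exact: unif_diffZ (unif_diff_mul id).
  move=> /(unif_diff_eq (G := fun y x : C => l 1 *: (x * y))) m2.
  have {}m2 := m2 (fun x y => congr1 _ (mulrC x y)).
  have [k1 d1] := unif_diffB b1 m1; have [k2 d2] := unif_diffB b2 m2.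
  split; [|split].
  + by move=> c; split; [case: (d1 c)|case: (d2 c)].
  + exists (maxn k1 k2) => c; split.
      by apply: Dord_le (leq_maxl _ _) _; case: (d1 c).
    by apply: Dord_le (leq_maxr _ _) _; case: (d2 c).
  (* The normalization holds because [iotaA 1] is the unit of [st']. *)
  + move=> c; have [h1 h2] := s1' _ (isA_iota c).
    by rewrite h1 // h2 // mul1r mulr1 /iotaA subrr.
- by move=> x y l hl; rewrite addrC subrK.
Qed.

End Gauge.

End DifferentialFamilies.

Theorem theorem8p4 (K : fieldType) (R C : comAlgType K)
    (st st' : @Araw K R C -> @Araw K R C -> @Araw K R C)
    (g : @Araw K R C -> @Araw K R C) :
  [pchar K] =i pred0 ->
  @param_algebra K R ->
  @smooth_alg K C -> @integral_alg K C ->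
  star_product st -> star_product st' ->
  gauge g ->
  (forall a1 a2, isA a1 -> isA a2 -> eqA (g (st a1 a2)) (st' (g a1) (g a2))) ->
  diff_star st ->
  (diff_star st' <-> diff_gauge g).
Proof.
move=> _ paramR _ _ hst hst' hg hom dst; split=> [dst'|dg].
  apply: differential_diff_gauge => //.
  exact: (gauge_differential paramR hg hst hst' hom dst dst').
apply: (gauge_diff_star paramR hg hst hst' hom dst).
exact: diff_gauge_differential.
Qed.
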